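(* Let $\mathbb{X}$ be a real ordered vector space, $x,y\in\mathbb{X}$ with $x\le y$, and let $\mathbb{Y}$ be an absolute order unit space having vector lattice structure which is Dedekind complete. Let $\mathcal{BV}$ be the space of all functions $[x,y]\to\mathbb{Y}$ of bounded variation and $\mathcal{BV}_0^+$ the set of monotonically increasing $f\in\mathcal{BV}$ with $f([x,y])\subseteq\mathbb{Y}^+$. For $f\in\mathcal{BV}$ write $$\|f\|=\inf_{g\in\mathcal{BV}_0^+}\{\|g\|_{\mathcal{BV}}: g\pm f\in\mathcal{BV}_0^+\}.$$ Then $(\mathcal{BV},\|\cdot\|)$, ordered by the cone $\mathcal{BV}_0^+$, is an ordered normed space.
   Context: A real ordered vector space is a real vector space $\mathbb{V}$ with a cone $\mathbb{V}^+$ (non-empty, closed under addition and under multiplication by non-negative reals); $u\le v$ means $v-u\in\mathbb{V}^+$, and $u<v$ means $u\le v$ and $u\neq v$. An ordered normed space is a real ordered vector space equipped with a norm. For $x\le y$ in $\mathbb{X}$, $[x,y]=\{z\in\mathbb{X}: x\le z\le y\}$. A partition $\mathcal{P}$ of $[x,y]$ is a finite chain $x=x_0<x_1<\cdots<x_{n_{\mathcal P}}=y$ of points of $[x,y]$. A function $f:[x,y]\to\mathbb{Y}$ is of bounded variation if $\mathcal{V}(f)=\sup\{\sum_{i=1}^{n_{\mathcal P}}|f(x_i)-f(x_{i-1})|:\mathcal P \text{ a partition of }[x,y]\}$ exists in $\mathbb{Y}$. A function $h$ is monotonically increasing if $z_1\le z_2$ implies $h(z_1)\le h(z_2)$. $\|g\|_{\mathcal{BV}}=\big\||g(x)|+\mathcal{V}(g)\big\|$,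 with $\|\cdot\|$ on $\mathbb{Y}$ the order unit norm. An absolutely ordered space is a real ordered vector space $(\mathbb{V},\mathbb{V}^+)$ with a map $|\cdot|:\mathbb{V}\to\mathbb{V}^+$ such that: (a) $|u|=u$ for $u\in\mathbb{V}^+$; (b) $|u|\pm u\in\mathbb{V}^+$ for all $u$; (c) $|\alpha u|=|\alpha||u|$ for all $u\in\mathbb{V},\alpha\in\mathbb{R}$; (d) if $|u-v|=u+v$ and $0\le w\le v$, then $|u-w|=u+w$; (e) if $|u-v|=u+v$ and $|u-w|=u+w$, then $\big|u-|v\pm w|\big|=u+|v\pm w|$. An element $e\in\mathbb{V}^+$ is an order unit if for each $v$ there is $\epsilon>0$ with $\epsilon e\pm v\in\mathbb{V}^+$; when $\mathbb{V}^+$ is proper ($\mathbb{V}^+\cap-\mathbb{V}^+=\{0\}$) and Archimedean ($\epsilon w+v\in\mathbb{V}^+$ for all $\epsilon>0$ and a fixed $w\in\mathbb{V}^+$ implies $v\in\mathbb{V}^+$), the order unit norm is $\|v\|=\inf\{\epsilon>0:\epsilon e\pm v\in\mathbb{V}^+\}$. For $u,v\in\mathbb{V}^+$: $u\perp v$ means $|u-v|=u+v$; $u\perp_\infty v$ means $\|\alpha u+\beta v\|=\max\{\|\alpha u\|,\|\beta v\|\}$ for all real $\alpha,\beta$; $u\perp_\infty^a v$ means $u_1\perp_\infty v_1$ whenever $0\le u_1\le u$, $0\le v_1\le v$. An absolute order unit space is an absolutely ordered space with an order unit norm determined by an order unit $e$, norm-closed $\mathbb{V}^+$, and $\perp=\perp_\infty^a$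 on $\mathbb{V}^+$. ''Having vector lattice structure'' means $\mathbb{Y}$ is a vector lattice with $|u|=u\vee(-u)$; it is Dedekind complete if every non-empty subset that is bounded above has a supremum. *)

(* Defs.v *)
From HB Require Import structures.
From mathcomp Require Import all_boot all_order all_algebra.
From mathcomp Require Import all_classical all_reals all_analysis.

Set Implicit Arguments.
Unset Strict Implicit.
Unset Printing Implicit Defensive.

Import Order.TTheory GRing.Theory Num.Theory.
Import numFieldNormedType.Exports.

Local Open Scope classical_set_scope.
Local Open Scope ring_scope.

(* Cones need not be proper, so [cle C] is only a preorder in general; this is
   why MathComp's porderType is not used here. *)
Record is_cone (R : realType) (V : lmodType R) (C : set V) : Prop := {
  cone_nonempty : C !=set0;
  cone_add : forall u v, C u -> C v -> C (u + v);
  cone_scale : forall (a : R) u, 0 <= a -> C u -> C (a *: u)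
}.

Section ConeOrder.
Variables (R : realType) (V : lmodType R) (C : set V).

Definition cle (u v : V) : Prop := C (v - u).

Definition clt (u v : V) : Prop := cle u v /\ u <> v.

Definition cinterval (u v : V) : set V := [set z | cle u z /\ cle z v].

Definition is_upper_bound (A : set V) (s : V) : Prop := forall a, A a -> cle a s.

Definition is_lower_bound (A : set V) (s : V) : Prop := forall a, A a -> cle s a.

Definition is_sup (A : set V) (s : V) : Prop :=
  is_upper_bound A s /\ forall b, is_upper_bound A b -> cle s b.

Definition is_inf (A : set V) (s : V) : Prop :=
  is_lower_bound A s /\ forall b, is_lower_bound A b -> cle b s.

Definition is_proper : Prop := forall u, C u -> C (- u) -> u = 0.

Definition is_archimedean : Prop :=
  forall w v, C w -> (forall eps : R, 0 < eps -> C (eps *: w + v)) -> C v.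

Definition is_order_unit (e : V) : Prop :=
  C e /\
  forall v, exists2 eps : R, 0 < eps & C (eps *: e + v) /\ C (eps *: e - v).

Definition order_unit_norm (e v : V) : R :=
  inf [set eps | 0 < eps /\ C (eps *: e + v) /\ C (eps *: e - v)].

Definition dedekind_complete : Prop :=
  forall A : set V, A !=set0 -> (exists b, is_upper_bound A b) ->
    exists s, is_sup A s.

Lemma cinterval_left (u v : V) : is_cone C -> cle u v -> cinterval u v u.
Proof.
move=> [[w Cw] _ Cscale] uv; split=> //.
by rewrite /cle subrr -(scale0r w); apply: Cscale.
Qed.

End ConeOrder.

Record absolutely_ordered (R : realType) (V : lmodType R)
    (C : set V) (abs : V -> V) : Prop := {
  abs_cone : is_cone C;
  abs_in_cone : forall u, C (abs u);
  abs_id : forall u, C u -> abs u = u;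
  abs_pm : forall u, C (abs u + u) /\ C (abs u - u);
  abs_scale : forall (a : R) u, abs (a *: u) = `|a| *: abs u;
  abs_orth_le : forall u v w,
    abs (u - v) = u + v -> cle C 0 w -> cle C w v -> abs (u - w) = u + w;
  abs_orth_pm : forall u v w,
    abs (u - v) = u + v -> abs (u - w) = u + w ->
    abs (u - abs (v + w)) = u + abs (v + w) /\
    abs (u - abs (v - w)) = u + abs (v - w)
}.

Definition orth (R : realType) (V : lmodType R) (abs : V -> V) (u v : V) : Prop :=
  abs (u - v) = u + v.

Definition orth_inf (R : realType) (V : normedModType R) (u v : V) : Prop :=
  forall a b : R, `|a *: u + b *: v| = Num.max `|a *: u| `|b *: v|.

Definition orth_inf_abs (R : realType) (V : normedModType R) (C : set V)
    (u v : V) : Prop :=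
  forall u1 v1, cle C 0 u1 -> cle C u1 u -> cle C 0 v1 -> cle C v1 v ->
    orth_inf u1 v1.

(* The norm of the normedModType is required to be the order unit norm of [e],
   so [closed] is closedness for that norm. *)
Record absolute_order_unit_space (R : realType) (V : normedModType R)
    (C : set V) (abs : V -> V) (e : V) : Prop := {
  aous_absolutely_ordered : absolutely_ordered C abs;
  aous_proper : is_proper C;
  aous_archimedean : is_archimedean C;
  aous_order_unit : is_order_unit C e;
  aous_norm : forall v : V, `|v| = order_unit_norm C e v;
  aous_closed : closed C;
  aous_orth : forall u v, C u -> C v -> orth abs u v <-> orth_inf_abs C u v
}.

Record vector_lattice_structure (R : realType) (V : lmodType R)
    (C : set V) (abs : V -> V) : Prop := {
  lattice_sup : forall u v, exists s, is_sup C [set u; v] s;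
  lattice_inf : forall u v, exists s, is_inf C [set u; v] s;
  lattice_abs : forall u, is_sup C [set u; - u] (abs u)
}.

(* A real ordered vector space with a norm, carried by a linear subspace [W]
   of an ambient space; [C] is the cone and [N] the norm on [W]. *)
Record ordered_normed_subspace (R : realType) (V : lmodType R)
    (W C : set V) (N : V -> R) : Prop := {
  ons_subspace : GRing.submod_closed [in W];
  ons_cone : is_cone C;
  ons_cone_sub : C `<=` W;
  ons_norm_ge0 : forall u, W u -> 0 <= N u;
  ons_norm_eq0 : forall u, W u -> N u = 0 -> u = 0;
  ons_norm_scale : forall (a : R) u, W u -> N (a *: u) = `|a| * N u;
  ons_norm_triangle : forall u v, W u -> W v -> N (u + v) <= N u + N v
}.

Section BoundedVariation.
Variables (R : realType) (X : lmodType R) (CX : set X) (x y : X).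
Variables (Y : normedModType R) (CY : set Y) (abs : Y -> Y).

Let I : Type := cinterval CX x y.

(* Only [p 0, ..., p n] matter.  The one-point chain [n = 0] is possible only
   when [x = y]. *)
Definition is_partition (n : nat) (p : nat -> I) : Prop :=
  [/\ val (p 0%N) = x, val (p n) = y &
      forall i, (i < n)%N -> clt CX (val (p i)) (val (p i.+1))].

Definition variation_sums (f : I -> Y) : set Y :=
  [set t | exists n (p : nat -> I),
     is_partition n p /\ t = \sum_(i < n) abs (f (p i.+1) - f (p i))].

Definition BV : set (I -> Y) :=
  [set f | exists s, is_sup CY (variation_sums f) s].

(* The supremum when it exists (it is unique if [CY] is proper), 0 otherwise. *)
Definition variation (f : I -> Y) : Y :=
  xget 0 [set s | is_sup CY (variation_sums f) s].

Definition mono_increasing (f : I -> Y) : Prop :=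
  forall z1 z2 : I, cle CX (val z1) (val z2) -> cle CY (f z1) (f z2).

Definition BV0p : set (I -> Y) :=
  [set f | BV f /\ mono_increasing f /\ forall z, CY (f z)].

Variables (hCX : is_cone CX) (hxy : cle CX x y).

Definition left_end : I := SigSub (mem_set (cinterval_left hCX hxy)).

Definition norm_BV (g : I -> Y) : R := `|abs (g left_end) + variation g|.

(* [inf] is MathComp-Analysis' real infimum, which is 0 on the empty set;
   a definite norm on [BV] therefore needs the set to be nonempty for f != 0,
   and for f = 0 it contains the value at g = 0. *)
Definition norm_BV0p (f : I -> Y) : R :=
  inf [set norm_BV g | g in [set g | BV0p g /\ BV0p (g + f) /\ BV0p (g - f)]].

End BoundedVariation.

(* Main.v *)
Require Import Defs.
From HB Require Import structures.
From mathcomp Require Import all_boot all_order all_algebra.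
From mathcomp Require Import all_classical all_reals all_analysis.

(** The proof rests on two observations about monotone functions.

    For an increasing [g] with values in the cone, every variation sum
    telescopes to [g y - g x], so the variation of [g] is [g y - g x], and
    [norm_BV g] collapses to the norm [`|g y|] of the terminal value
    ([norm_BV_increasing]).  Hence the norm of [f] is the infimum of [`|g y|]
    over the [g] that dominate [f], meaning that [g], [g + f] and [g - f] are
    all increasing and positive.

    Such a [g] exists for every [f] of bounded variation: Jordan's majorant
    [g z = |f x| + V z], where [V z] is the variation of [f] along the chains
    from [x] to [z] ([dominates_jordan_majorant]).  The suprema [V z] exist by
    Dedekind completeness, because a chain ending at [z] extends to one ending
    at [y]; and [V z1 + |f z2 - f z1| <= V z2] for [z1 <= z2], because a chain
    ending at [z1] extends to one ending at [z2].

    The norm axioms follow.  Domination is compatible with sums and with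
    scaling by [`|a|], which gives the triangle inequality and homogeneity.  If
    [g] dominates [f] then [- g y <= f z <= g y] for every [z], so
    [`|f z| <= `|g y|] by monotonicity of the order unit norm; if the infimum
    is [0] then [f = 0].

    The cone of the domain may fail to be proper, in which case chains can run
    around cycles.  Nothing above is affected: chains are only ever extended at
    their final end, by a point above the last one. *)

Set Implicit Arguments.
Unset Strict Implicit.
Unset Printing Implicit Defensive.

Import Order.TTheory GRing.Theory Num.Theory.
Import numFieldNormedType.Exports.

Local Open Scope classical_set_scope.
Local Open Scope ring_scope.

(** * The preorder of a cone *)

Section ConeTheory.
Variables (R : realType) (V : lmodType R) (C : set V).
Hypothesis hC : is_cone C.

Lemma cone0 : C 0.
Proof.
by case: hC => -[w Cw] _ sc; rewrite -(scale0r w); apply: sc.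
Qed.

Lemma cle0E u : cle C 0 u = C u.
Proof. by rewrite /cle subr0. Qed.

Lemma cle_refl u : cle C u u.
Proof. by rewrite /cle subrr; exact: cone0. Qed.

Lemma cle_trans u v w : cle C u v -> cle C v w -> cle C u w.
Proof.
move=> uv vw; rewrite /cle -(subrKA v) addrC.
by rewrite [X in C X]addrC; apply: (cone_add hC).
Qed.

Lemma cleD u v u' v' : cle C u v -> cle C u' v' -> cle C (u + u') (v + v').
Proof. by move=> uv uv'; rewrite /cle opprD addrACA; apply: (cone_add hC). Qed.

Lemma cle_addr u v w : cle C (u + v) w <-> cle C u (w - v).
Proof. by rewrite /cle opprD addrA addrAC. Qed.

Lemma cle_scale (a : R) u v : 0 <= a -> cle C u v -> cle C (a *: u) (a *: v).
Proof. by move=> a0 uv; rewrite /cle -scalerBr; apply: (cone_scale hC). Qed.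

Lemma cle_sum n (F G : nat -> V) : (forall i, cle C (F i) (G i)) ->
  cle C (\sum_(i < n) F i) (\sum_(i < n) G i).
Proof.
move=> FG; elim: n => [|n IH]; first by rewrite !big_ord0; exact: cle_refl.
by rewrite !big_ord_recr; apply: cleD.
Qed.

Lemma is_sup_unique A s t : is_proper C -> is_sup C A s -> is_sup C A t -> s = t.
Proof.
move=> pC [us ls] [ut lt]; apply/eqP; rewrite -subr_eq0; apply/eqP.
by apply: pC; rewrite ?opprB; [exact: lt | exact: ls].
Qed.

End ConeTheory.

Lemma cinterval_right (R : realType) (V : lmodType R) (C : set V) (u v : V) :
  is_cone C -> cle C u v -> cinterval C u v v.
Proof. by move=> hC uv; split=> //; exact: cle_refl. Qed.

(** * The absolute value of a vector lattice and the order unit norm *)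

Section AbsTheory.
Variables (R : realType) (V : lmodType R) (C : set V) (abs : V -> V).
Hypotheses (hV : absolutely_ordered C abs) (hlat : vector_lattice_structure C abs).
Let hC := abs_cone hV.

Lemma abs0 : abs 0 = 0.
Proof. by rewrite (abs_id hV)//; exact: cone0. Qed.

Lemma cle_abs u : cle C u (abs u).
Proof. by case: (lattice_abs hlat u) => ub _; apply: ub; left. Qed.

Lemma cleN_abs u : cle C (- u) (abs u).
Proof. by case: (lattice_abs hlat u) => ub _; apply: ub; right. Qed.

Lemma abs_le u w : cle C u w -> cle C (- u) w -> cle C (abs u) w.
Proof. by move=> uw nuw; case: (lattice_abs hlat u) => _; apply=> a [->|->]. Qed.

Lemma cle_abs_triangle u v : cle C (abs (u + v)) (abs u + abs v).
Proof.
apply: abs_le; rewrite ?opprD; apply: (cleD hC); by [exact: cle_abs | exact: cleN_abs].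
Qed.

End AbsTheory.

(** The order unit norm is monotone: [- u <= v <= u] bounds the norm of [v]
    because every [eps] admissible for [u] is admissible for [v]. *)
Lemma order_unit_norm_le (R : realType) (V : lmodType R) (C : set V) (e u v : V) :
  is_cone C -> is_order_unit C e -> C (u + v) -> C (u - v) ->
  order_unit_norm C e v <= order_unit_norm C e u.
Proof.
move=> hC [_ he] uDv uBv; apply: lb_le_inf => [|eps [eps0 [epsD epsB]]].
  by have [eps eps0 epsC] := he u; exists eps.
apply: ge_inf; first by exists 0 => eps' [/ltW].
split=> //; split.
  by rewrite -(subrKA u); apply: (cone_add hC).
by rewrite -(subrKA u); apply: (cone_add hC).
Qed.

(** * Chains and variation in a Dedekind complete vector lattice *)

Section Variation.
Variables (R : realType) (X : lmodType R) (CX : set X) (x y : X).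
Hypotheses (hCX : is_cone CX) (hxy : cle CX x y).
Variables (Y : normedModType R) (CY : set Y) (abs : Y -> Y) (e : Y).
Hypotheses (hY : absolute_order_unit_space CY abs e)
  (hlat : vector_lattice_structure CY abs) (hded : dedekind_complete CY).

Let hA := aous_absolutely_ordered hY.
Let hC := abs_cone hA.
Let hP := aous_proper hY.

Local Notation I := (cinterval CX x y).
Local Notation x0 := (left_end hCX hxy).

Definition right_end : I := SigSub (mem_set (cinterval_right hCX hxy)).

Local Notation y0 := right_end.

Lemma left_end_le (z : I) : cle CX (val x0) (val z).
Proof. by have [] := set_mem (valP z). Qed.

Lemma right_end_ge (z : I) : cle CX (val z) (val y0).
Proof. by have [] := set_mem (valP z). Qed.

(** Letting the end point [z] vary, while chains stay inside the full interval,
    is what makes the running variation [z |-> V z] expressible without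
    restricting [f] to subintervals. *)
Definition chain_sums (f : I -> Y) (z : I) : set Y :=
  [set t | exists n (p : nat -> I),
     [/\ p 0%N = x0, p n = z, forall i, (i < n)%N -> clt CX (val (p i)) (val (p i.+1))
       & t = \sum_(i < n) abs (f (p i.+1) - f (p i))]].

Lemma variation_sumsE (f : I -> Y) : variation_sums abs f = chain_sums f y0.
Proof.
apply/seteqP; split => t.
  by case=> n [p [[p0 pn hp] ->]]; exists n, p; split=> //; exact: val_inj.
by case=> n [p [p0 pn hp ->]]; exists n, p; rewrite /is_partition p0 pn.
Qed.

Lemma chain_sums_left (f : I -> Y) : chain_sums f x0 0.
Proof. by exists 0%N, (fun=> x0); rewrite big_ord0. Qed.

(** Chains are extended by one final step.  Since [abs 0 = 0], the formula also
    covers [z1 = z2], where the extended chain would not be strict. *)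
Lemma chain_sums_extend (f : I -> Y) (z1 z2 : I) s :
  cle CX (val z1) (val z2) -> chain_sums f z1 s ->
  chain_sums f z2 (s + abs (f z2 - f z1)).
Proof.
have [->|/eqP z12] := eqVneq z1 z2; first by rewrite subrr (abs0 hA) addr0.
move=> le12 [n [p [p0 pn hp ->]]].
exists n.+1, (fun i => if (i <= n)%N then p i else z2); split=> //.
- by rewrite ltnn.
- move=> i; rewrite ltnS => lein.
  have /predU1P[->|ltin] : (i == n) || (i < n)%N by rewrite -leq_eqVlt.
    by rewrite leqnn ltnn pn; split=> // /val_inj.
  by rewrite lein ltin; exact: hp.
- rewrite big_ord_recr /= ltnn leqnn pn; congr (_ + _).
  by apply: eq_bigr => i _; rewrite ltn_ord ltnW.
Qed.

Lemma chain_sums_nonempty (f : I -> Y) (z : I) : chain_sums f z !=set0.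
Proof.
exists (0 + abs (f z - f x0)).
by apply: chain_sums_extend; [exact: left_end_le | exact: chain_sums_left].
Qed.

(** By Dedekind completeness a bound suffices, as the set of sums is never
    empty: from the one-point chain at [x] one reaches [y] in at most one step. *)
Lemma BV_bounded (f : I -> Y) b :
  is_upper_bound CY (variation_sums abs f) b -> BV CY abs f.
Proof.
move=> fb; apply: hded; last by exists b.
by rewrite variation_sumsE; exact: chain_sums_nonempty.
Qed.

Lemma BV_linear (a : R) (f g : I -> Y) :
  BV CY abs f -> BV CY abs g -> BV CY abs (a *: f + g).
Proof.
move=> [s [us _]] [t [ut _]]; apply: (@BV_bounded _ (`|a| *: s + t)).
move=> _ [n [p [hp ->]]].
pose F (h : I -> Y) i := abs (h (p i.+1) - h (p i)).
apply: (@cle_trans _ _ _ hC _ (\sum_(i < n) (`|a| *: F f i + F g i))).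
  apply: (cle_sum hC n (F := F (a *: f + g)) (G := fun i => `|a| *: F f i + F g i)).
  move=> i; rewrite /F /= opprD addrACA -scalerBr -(abs_scale hA).
  exact: cle_abs_triangle.
rewrite big_split -scaler_sumr; apply: (cleD hC); first apply: (cle_scale hC) => //.
  by apply: us; exists n, p.
by apply: ut; exists n, p.
Qed.

Lemma variation_sums_increasing (f : I -> Y) :
  mono_increasing CY f -> variation_sums abs f = [set f y0 - f x0].
Proof.
move=> fm; have tel t : variation_sums abs f t -> t = f y0 - f x0.
  rewrite variation_sumsE => -[n [p [p0 pn hp ->]]].
  rewrite -(big_mkord xpredT (fun i => abs (f (p i.+1) - f (p i)))).
  rewrite (telescope_sumr_eq (f \o p)) //= ?p0 ?pn// => k kn.
  by apply: (abs_id hA); apply: fm; case: (hp _ kn).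
apply/seteqP; split => [|_ ->]; first exact: tel.
have [t] := chain_sums_nonempty f y0; rewrite -variation_sumsE => ft.
by rewrite -(tel _ ft).
Qed.

Lemma is_sup_variation_increasing (f : I -> Y) : mono_increasing CY f ->
  is_sup CY (variation_sums abs f) (f y0 - f x0).
Proof.
move=> fm; rewrite variation_sums_increasing//.
by split=> [_ ->|b]; [exact: (cle_refl hC) | apply].
Qed.

(** Telescoping gives the variation of an increasing function for free, and
    positivity propagates from the left end, the least point of the interval. *)
Lemma BV0pP (f : I -> Y) :
  BV0p CY abs f <-> mono_increasing CY f /\ CY (f x0).
Proof.
split=> [[_ [fm fp]]//|[fm f0]]; split.
  by exists (f y0 - f x0); exact: is_sup_variation_increasing.
split=> // z; rewrite -cle0E; apply: (cle_trans hC (v := f x0)); first by rewrite cle0E.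
by apply: fm; exact: left_end_le.
Qed.

(** The terms combine to [g x + (g y - g x)]. *)
Lemma norm_BV_increasing (g : I -> Y) :
  BV0p CY abs g -> norm_BV CY abs hCX hxy g = `|g y0|.
Proof.
move=> [_ [gm gp]]; rewrite /norm_BV (abs_id hA)//.
suff -> : Defs.variation CY abs g = g y0 - g x0 by rewrite subrKC.
apply: xget_unique; first exact: is_sup_variation_increasing.
by move=> t ht; apply: (is_sup_unique hP ht); exact: is_sup_variation_increasing.
Qed.

Lemma BV0p_cone : is_cone (BV0p CY abs : set (I -> Y)).
Proof.
split.
- exists 0; apply/BV0pP; split; last exact: (cone0 hC).
  by move=> z1 z2 _; exact: (cle_refl hC).
- move=> u v /BV0pP[um u0] /BV0pP[vm v0]; apply/BV0pP.
  split; last exact: (cone_add hC).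
  by move=> z1 z2 z12; apply: (cleD hC); [exact: um | exact: vm].
- move=> a u a0 /BV0pP[um u0]; apply/BV0pP; split; last exact: (cone_scale hC).
  by move=> z1 z2 z12; apply: (cle_scale hC a0); exact: um.
Qed.

(** * Domination and the Jordan majorant *)

Definition dominates (g f : I -> Y) : Prop :=
  [/\ BV0p CY abs g, BV0p CY abs (g + f) & BV0p CY abs (g - f)].

Lemma dominatesD g f g' f' :
  dominates g f -> dominates g' f' -> dominates (g + g') (f + f').
Proof.
have addC := cone_add BV0p_cone.
move=> [? ? ?] [? ? ?]; split; rewrite ?opprD; first exact: addC.
  by rewrite addrACA; exact: addC.
by rewrite addrACA; exact: addC.
Qed.

Lemma dominatesZ (a : R) g f : dominates g f -> dominates (`|a| *: g) (a *: f).
Proof.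
have scaleC := cone_scale BV0p_cone.
move=> [g0 gDf gBf]; split; first exact: scaleC.
- have [a0|a0] := ger0P a; first by rewrite -scalerDr; exact: scaleC.
  rewrite (_ : _ + _ = - a *: (g - f)); last first.
    by rewrite scalerBr [X in _ = _ - X]scaleNr opprK.
  apply: scaleC => //.
  by rewrite oppr_ge0 ltW.
- have [a0|a0] := ger0P a; first by rewrite -scalerBr; exact: scaleC.
  rewrite -scaleNr -scalerDr; apply: scaleC => //.
  by rewrite oppr_ge0 ltW.
Qed.

(** The running variation [V] satisfies [V z1 + |f z2 - f z1| <= V z2], so
    adding or subtracting [f] leaves it increasing; the constant [|f x|] makes
    the results positive at the left end, hence everywhere. *)
Lemma dominates_jordan_majorant (f : I -> Y) : BV CY abs f -> exists g, dominates g f.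
Proof.
move=> [s [us _]].
have supV z : exists v, is_sup CY (chain_sums f z) v.
  apply: hded; [exact: chain_sums_nonempty | exists s => t ft].
  apply: (cle_trans hC (v := t + abs (f y0 - f z))).
    by rewrite /cle addrAC subrr add0r; exact: (abs_in_cone hA).
  apply: us; rewrite variation_sumsE.
  by apply: chain_sums_extend => //; exact: right_end_ge.
have [V supVz] := choice supV.
have V_step z1 z2 : cle CX (val z1) (val z2) ->
    cle CY (V z1 + abs (f z2 - f z1)) (V z2).
  move=> z12; apply/cle_addr; have [_ lV] := supVz z1; apply: lV => t ft.
  by apply/cle_addr; have [uV _] := supVz z2; apply/uV/chain_sums_extend.
have V0 : CY (V x0).
  by rewrite -cle0E; have [uV _] := supVz x0; apply: uV; exact: chain_sums_left.
(* The increments of [f], of [- f] and of [0] are all bounded by those of [V]. *)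
have majorant (h : I -> Y) :
    (forall z1 z2, cle CY (h z1 - h z2) (abs (f z2 - f z1))) ->
    cle CY (- h x0) (abs (f x0)) ->
    BV0p CY abs ((fun z => abs (f x0) + V z) + h).
  move=> hf h0; apply/BV0pP; split; last first.
    rewrite -[X in CY X]/(abs (f x0) + V x0 + h x0) addrAC.
    by apply: (cone_add hC) => //; move: h0; rewrite /cle opprK.
  move=> z1 z2 z12; have step : cle CY (V z1 + h z1) (V z2 + h z2).
    rewrite -[h z1](subrK (h z2)) addrA; apply: (cleD hC); last exact: (cle_refl hC).
    apply: (cle_trans hC _ (V_step _ _ z12)); apply: (cleD hC) => //.
    exact: (cle_refl hC).
  by have := cleD hC (cle_refl hC (abs (f x0))) step; rewrite !addrA.
exists (fun z => abs (f x0) + V z); split.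
- rewrite -[X in BV0p _ _ X]addr0; apply: majorant => [z1 z2|];
    by rewrite ?subrr ?oppr0 cle0E; exact: (abs_in_cone hA).
- apply: majorant => [z1 z2|]; last exact: (cleN_abs hlat).
  by rewrite -opprB; exact: (cleN_abs hlat).
- apply: majorant => [z1 z2|] /=; last by rewrite opprK; exact: (cle_abs hlat).
  by rewrite opprK addrC; exact: (cle_abs hlat).
Qed.

(** On [f z] the domination reads [- g z <= f z <= g z], and [g z <= g y]. *)
Lemma norm_le_dominating (g f : I -> Y) z : dominates g f -> `|f z| <= `|g y0|.
Proof.
move=> [[_ [gm _]] [_ [_ gDf]] [_ [_ gBf]]]; rewrite !(aous_norm hY).
have gz : CY (g y0 - g z) by apply: gm; exact: right_end_ge.
apply: (order_unit_norm_le hC (aous_order_unit hY)).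
  by rewrite -(subrK (g z) (g y0)) -addrA; apply: (cone_add hC) => //; exact: gDf.
by rewrite -(subrK (g z) (g y0)) -addrA; apply: (cone_add hC) => //; exact: gBf.
Qed.

(** * The norm as an infimum of terminal values *)

Local Notation N := (@norm_BV0p R X CX x y Y CY abs hCX hxy).

Lemma norm_BV0p_le (g f : I -> Y) : dominates g f -> N f <= `|g y0|.
Proof.
move=> gf; apply: ge_inf; first by exists 0 => _ [h _ <-]; exact: normr_ge0.
by have [g0 gDf gBf] := gf; exists g => //; exact: norm_BV_increasing.
Qed.

(** The bounded variation of [f] matters here: the infimum of an empty set is [0],
    and the Jordan majorant is what makes the set nonempty. *)
Lemma le_norm_BV0p (f : I -> Y) (c : R) : BV CY abs f ->
  (forall g, dominates g f -> c <= `|g y0|) -> c <= N f.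
Proof.
move=> /dominates_jordan_majorant[g [g0 gDf gBf]] hc; apply: lb_le_inf.
  by exists (norm_BV CY abs hCX hxy g), g.
by move=> _ [h [h0 [hDf hBf]] <-]; rewrite norm_BV_increasing//; apply: hc.
Qed.

(** Only one inequality is needed: for [a != 0] the other one is this one applied
    to [a *: f] and [a^-1]. *)
Lemma norm_BV0p_scale_le (a : R) (f : I -> Y) : BV CY abs f ->
  N (a *: f) <= `|a| * N f.
Proof.
move=> fBV; have [->|a0] := eqVneq a 0.
  have [g gf] := dominates_jordan_majorant fBV; rewrite normr0 mul0r.
  apply: (le_trans (norm_BV0p_le (dominatesZ 0 gf))).
  by rewrite normr0 scale0r normr0.
rewrite -ler_pdivrMl ?normr_gt0//; apply: le_norm_BV0p => // g gf.
rewrite ler_pdivrMl ?normr_gt0//; apply: (le_trans (norm_BV0p_le (dominatesZ a gf))).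
by rewrite normrZ normr_id.
Qed.

End Variation.

Theorem corollary4p9 (R : realType)
    (X : lmodType R) (CX : set X) (hCX : is_cone CX)
    (x y : X) (hxy : cle CX x y)
    (Y : normedModType R) (CY : set Y) (abs : Y -> Y) (e : Y)
    (hY : absolute_order_unit_space CY abs e)
    (hlat : vector_lattice_structure CY abs)
    (hded : dedekind_complete CY) :
  ordered_normed_subspace
    (@BV R X CX x y Y CY abs)
    (@BV0p R X CX x y Y CY abs)
    (@norm_BV0p R X CX x y Y CY abs hCX hxy).
Proof.
have coneBV0p := BV0p_cone hCX hxy hY.
have scaleBV (a : R) f : @BV R X CX x y Y CY abs f -> BV CY abs (a *: f).
  move=> fBV; rewrite -[a *: f]addr0.
  by apply: (BV_linear hCX hxy hY hlat hded) => //; have [] := cone0 coneBV0p.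
have le_norm := @le_norm_BV0p _ _ _ _ _ hCX hxy _ _ _ _ hY hlat hded.
have norm_le := norm_BV0p_le hCX hxy hY.
have scale_le := norm_BV0p_scale_le hCX hxy hY hlat hded.
split=> //.
- split; first by apply: mem_set; have [] := cone0 coneBV0p.
  move=> a u v /set_mem uBV /set_mem vBV; apply: mem_set.
  exact: (BV_linear hCX hxy hY hlat hded).
- by move=> f [].
- by move=> f fBV; apply: le_norm.
- move=> f fBV Nf0; apply/funext => z; apply/eqP; rewrite -normr_le0 -Nf0.
  by apply: le_norm => // g; exact: (norm_le_dominating hCX hxy hY).
- move=> a f fBV; apply/eqP; rewrite eq_le scale_le//=.
  have [->|a0] := eqVneq a 0.
    by rewrite normr0 mul0r; apply: le_norm => //; exact: scaleBV.
  rewrite -ler_pdivlMl ?normr_gt0// -normfV -{1}[f](scalerK a0).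
  by apply: scale_le; exact: scaleBV.
- move=> u v uBV vBV; rewrite -lerBlDr; apply: (le_norm) => // g gu.
  rewrite lerBlDr -lerBlDl; apply: le_norm => // h hv; rewrite lerBlDl.
  by apply: (le_trans (norm_le _ _ (dominatesD hCX hxy hY gu hv))); exact: ler_normD.
Qed.
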